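(* Let $u$ and $v$ be twins in $X$. With respect to $M$, $u$ and $v$ are strongly cospectral if and only if they are parallel.
   Context: $X$ is a finite connected undirected graph with nonzero real edge weights, loops allowed, no multiple edges. $A$ is its adjacency matrix: $(A)_{j,\ell}$ is the weight of the edge $(j,\ell)$ (for $j=\ell$, the weight of the loop at $j$), and $0$ if there is no such edge. $\deg(u)=2(A)_{u,u}+\sum_{j\neq u}(A)_{u,j}$ and $D$ is the diagonal matrix of degrees. Fix real $\alpha,\beta,\gamma$ with $\gamma\neq0$. The generalized adjacency matrix is $\mathbf{A}=\alpha I+\beta D+\gamma A$. If all vertex degrees are positive or all are negative, the generalized normalized adjacency matrix is $\mathcal{A}=\alpha I+\gamma D^{-1/2}AD^{-1/2}$, where $D^{-1/2}$ is diagonal with $(D^{-1/2})_{u,u}=1/\sqrt{\deg(u)}$ if $\deg(u)>0$ and $-i/\sqrt{|\deg(u)|}$ if $\deg(u)<0$. $M$ denotes $\mathbf{A}$ or, when it is defined, $\mathcal{A}$; both are real symmetric. Let $M=\sum_j\lambda_jE_j$ be the spectral decomposition ($\lambda_j$ distinct eigenvalues, $E_j$ orthogonal projections onto the eigenspaces), and $\mathbf{e}_u$ the characteristic vector of $u$. With respect to $M$, $u,v$ are parallel if for each $j$ there exists $c\in\mathbb{R}$ with $E_j\mathbf{e}_u=cE_j\mathbf{e}_v$, and strongly cospectral if $E_j\mathbf{e}_u=\pm E_j\mathbf{e}_v$ for each $j$. Distinct vertices $u,v$ are twins if they have the same neighbours outside $\{u,v\}$, $(A)_{u,w}=(A)_{v,w}$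 for every $w\neq u,v$, and $(A)_{u,u}=(A)_{v,v}$. *)

(* Defs.v *)
From mathcomp Require Import all_boot all_order all_algebra.
From mathcomp Require Import complex.
From mathcomp Require Import reals ring.

Set Implicit Arguments.
Unset Strict Implicit.
Unset Printing Implicit Defensive.

Import Order.TTheory GRing.Theory Num.Theory.
Local Open Scope ring_scope.
Local Open Scope complex_scope.

(* Loops are edges [edge x x]; the weights of non-edges are irrelevant. *)
Record wgraph (R : realType) (n : nat) := WGraph {
  edge : rel 'I_n;
  weight : 'I_n -> 'I_n -> R;
  edge_sym : symmetric edge;
  weight_sym : forall x y, edge x y -> weight x y = weight y x;
  weight_neq0 : forall x y, edge x y -> weight x y != 0
}.

Section Graph.
Variables (R : realType) (n : nat) (X : wgraph R n).

Definition connected_graph : Prop := forall x y : 'I_n, connect (edge X) x y.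

Definition adj_mx : 'M[R]_n :=
  \matrix_(j, l) (if edge X j l then weight X j l else 0).

Definition deg (u : 'I_n) : R :=
  2 * adj_mx u u + \sum_(j < n | j != u) adj_mx u j.

Definition deg_mx : 'M[R]_n := diag_mx (\row_u deg u).

Definition gen_adj (alpha beta gamma : R) : 'M[R]_n :=
  alpha%:M + beta *: deg_mx + gamma *: adj_mx.

Definition degs_same_sign : Prop :=
  (forall u, 0 < deg u) \/ (forall u, deg u < 0).

(* Only used when no degree is zero, so the [else] branch means [deg u < 0]. *)
Definition inv_sqrt_deg (u : 'I_n) : R[i] :=
  if 0 < deg u then ((Num.sqrt (deg u))^-1)%:C
  else - 'i%C / (Num.sqrt `|deg u|)%:C.

Definition inv_sqrt_deg_mx : 'M[R[i]]_n := diag_mx (\row_u inv_sqrt_deg u).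

Definition norm_adj_C (alpha gamma : R) : 'M[R[i]]_n :=
  (alpha%:C)%:M +
  gamma%:C *: (inv_sqrt_deg_mx *m map_mx (real_complex R) adj_mx
                 *m inv_sqrt_deg_mx).

(* When all degrees have the same sign, [norm_adj_C] has real entries
   (lemma [norm_adjE]), so taking real parts only changes the type. *)
Definition norm_adj (alpha gamma : R) : 'M[R]_n :=
  map_mx (@complex.Re R) (norm_adj_C alpha gamma).

Definition twins (u v : 'I_n) : Prop :=
  [/\ u != v,
      forall w, w != u -> w != v -> edge X u w = edge X v w,
      forall w, w != u -> w != v -> adj_mx u w = adj_mx v w
    & adj_mx u u = adj_mx v v].

Lemma norm_adjE (alpha gamma : R) : degs_same_sign ->
  map_mx (real_complex R) (norm_adj alpha gamma) = norm_adj_C alpha gamma.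
Proof.
move=> hs; apply/matrixP => j l.
have entryE : norm_adj_C alpha gamma j l = (alpha%:C *+ (j == l)) +
    gamma%:C * (inv_sqrt_deg j * (adj_mx j l)%:C * inv_sqrt_deg l).
  by rewrite /norm_adj_C /inv_sqrt_deg_mx mul_mx_diag mul_diag_mx !mxE.
rewrite [LHS]mxE [X in real_complex R X]mxE entryE /inv_sqrt_deg.
set a := adj_mx j l.
have [z ->] : exists z : R,
   (if 0 < deg j then ((Num.sqrt (deg j))^-1)%:C
    else - 'i%C / (Num.sqrt `|deg j|)%:C) * a%:C *
   (if 0 < deg l then ((Num.sqrt (deg l))^-1)%:C
    else - 'i%C / (Num.sqrt `|deg l|)%:C) = z%:C.
  case: hs => hs.
    rewrite !hs; exists ((Num.sqrt (deg j))^-1 * a * (Num.sqrt (deg l))^-1).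
    by rewrite !rmorphM.
  rewrite !ltNge !(ltW (hs _)) /=.
  exists (- ((Num.sqrt `|deg j|)^-1 * a * (Num.sqrt `|deg l|)^-1)).
  rewrite rmorphN !rmorphM /= !fmorphV /=.
  set p := (_%:C)^-1; set q := (_%:C)^-1.
  have -> : - 'i%C * p * a%:C * (- 'i%C * q) = 'i%C ^+ 2 * (p * a%:C * q) by ring.
  by rewrite sqr_i mulN1r.
by rewrite -rmorphM -rmorphMn -rmorphD.
Qed.

End Graph.

Section Spectral.
Variables (R : realType) (n : nat).
Implicit Types (M : 'M[R]_n) (u v : 'I_n).

Definition char_vec u : 'cV[R]_n := delta_mx u 0.

(* Projection onto the eigenspace along its orthogonal complement: the rows of
   [kermx V^T] span the vectors orthogonal to all rows of [V].  MathComp's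
   [eigenspace] and [proj_mx] act on row vectors; for symmetric [M] left and
   right eigenspaces agree, and the projection is symmetric ([eigproj_sym]), so
   it may be applied to column vectors. *)
Definition eigproj M (lambda : R) : 'M[R]_n :=
  let V := eigenspace M lambda in proj_mx V (kermx V^T).

Definition parallel M u v : Prop :=
  forall lambda : R, eigenvalue M lambda ->
  exists c : R,
    eigproj M lambda *m char_vec u = c *: (eigproj M lambda *m char_vec v).

Definition strongly_cospectral M u v : Prop :=
  forall lambda : R, eigenvalue M lambda ->
    eigproj M lambda *m char_vec u = eigproj M lambda *m char_vec v \/
    eigproj M lambda *m char_vec u = - (eigproj M lambda *m char_vec v).

Lemma row_norm_eq0 (x : 'rV[R]_n) : x *m x^T = 0 -> x = 0.
Proof.
move=> /matrixP /(_ 0 0); rewrite !mxE => /eqP.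
rewrite psumr_eq0 => [/allP h|i _]; last by rewrite mxE -expr2 sqr_ge0.
apply/rowP => i; have := h i (mem_index_enum _).
by rewrite /= mxE -expr2 sqrf_eq0 mxE => /eqP.
Qed.

Lemma cap_orth (V : 'M[R]_n) : (V :&: kermx V^T = 0)%MS.
Proof.
apply/eqP/rowV0P => x; rewrite sub_capmx => /andP[/submxP[y ->]] /sub_kermxP h.
by apply: row_norm_eq0; rewrite trmx_mul mulmxA h mul0mx.
Qed.

Lemma add_orth (V : 'M[R]_n) : (1%:M <= V + kermx V^T)%MS.
Proof.
rewrite sub1mx /row_full eqn_leq rank_leq_col /=.
have := mxrank_sum_cap V (kermx V^T).
rewrite cap_orth mxrank0 addn0 => ->.
by rewrite mxrank_ker mxrank_tr subnKC ?rank_leq_col.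
Qed.

Lemma eigproj_idem M lambda :
  eigproj M lambda *m eigproj M lambda = eigproj M lambda.
Proof. by rewrite proj_mx_proj ?cap_orth. Qed.

Lemma eigproj_image M lambda :
  (eigproj M lambda :=: eigenspace M lambda)%MS.
Proof.
apply/eqmxP/andP; split; first by rewrite -[eigproj _ _]mul1mx proj_mx_sub.
set V := eigenspace M lambda.
by rewrite -[V in (V <= _)%MS](proj_mx_id (cap_orth V) (submx_refl V)) submxMl.
Qed.

Lemma eigproj_sym M lambda : (eigproj M lambda)^T = eigproj M lambda.
Proof.
set E := eigproj M lambda; set V := eigenspace M lambda.
have h : (1%:M - E) *m E^T = 0.
  have /sub_kermxP k : (1%:M - E <= kermx V^T)%MS.
    by rewrite -{1}(mul1mx E) proj_mx_compl_sub ?add_orth.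
  have /submxP[Y defE] : (E <= V)%MS by rewrite eigproj_image.
  by rewrite [in E^T]defE trmx_mul mulmxA k mul0mx.
have hE : E^T = E *m E^T.
  by apply/eqP; rewrite -subr_eq0 -{1}(mul1mx E^T) -mulmxBl h.
by apply: trmx_inj; rewrite hE trmx_mul trmxK.
Qed.

End Spectral.

(* Main.v *)
Require Import Defs.
From mathcomp Require Import all_boot all_order all_algebra.
From mathcomp Require Import perm complex.
From mathcomp Require Import reals.

(** Exchanging the twins [u] and [v] is a symmetry of the weighted graph, hence
    of the degrees and of [M] (lemmas [twins_gen_adj_swap] and
    [twins_norm_adj_swap]).  For a symmetric [M] with this invariance,
    [e_u - e_v] is an eigenvector of [M] ([swap_eigenvector]), so each spectral
    projection [E] either kills it or fixes it ([eigproj_eigenvector]).  In both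
    cases the diagonal entries [E u u] and [E v v] agree ([swap_eigproj_diag]).
    They are the squared lengths of [E e_u] and [E e_v], so an equation
    [E e_u = c E e_v] between these vectors of equal length forces [c = 1] or
    [c = -1], unless both vectors vanish.  The converse is immediate. *)

Set Implicit Arguments.
Unset Strict Implicit.
Unset Printing Implicit Defensive.

Import Order.TTheory GRing.Theory Num.Theory.
Local Open Scope ring_scope.

Section SpectralProjections.
Variables (R : realType) (n : nat).
Implicit Types (M : 'M[R]_n) (u v : 'I_n).

(** Eigenspaces of a symmetric matrix for different eigenvalues are orthogonal,
    so an eigenvector lies either in the eigenspace of [lambda] or in its
    orthogonal complement. *)
Lemma eigproj_eigenvector M (theta lambda : R) (w : 'rV[R]_n) :
    M^T = M -> w *m M = theta *: w ->
  exists k : R, w *m eigproj M lambda = k *: w.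
Proof.
move=> symM wM; have [<-|ne] := eqVneq theta lambda.
  exists 1; rewrite scale1r; apply: proj_mx_id; first exact: cap_orth.
  exact/eigenspaceP.
exists 0; rewrite scale0r; apply: proj_mx_0; first exact: cap_orth.
apply/sub_kermxP; set V := eigenspace M lambda.
have VM : V *m M = lambda *: V by apply/eigenspaceP.
(* both sides are [w *m M *m V^T], since the rows of [V] are eigenvectors of [M] *)
have : theta *: (w *m V^T) = lambda *: (w *m V^T).
  by rewrite scalemxAl -wM -mulmxA -[X in X *m V^T]symM -trmx_mul VM
             linearZ -scalemxAr.
by move/eqP; rewrite -subr_eq0 -scalerBl scaler_eq0 subr_eq0 (negPf ne) => /eqP.
Qed.

(** An orthogonal projection [E] satisfies [E = E^T *m E], so [E u u] is
    the squared length of [E e_u]. *)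
Lemma eigproj_col_norm M (lambda : R) u :
  (eigproj M lambda *m char_vec R u)^T *m (eigproj M lambda *m char_vec R u) =
    (eigproj M lambda u u)%:M.
Proof.
rewrite trmx_mul eigproj_sym mulmxA -[X in X *m _]mulmxA eigproj_idem.
by rewrite [LHS]mx11_scalar trmx_delta -rowE -colE !mxE.
Qed.

Lemma mul_delta_diff (E : 'M[R]_n) u v y :
  ((delta_mx 0 u - delta_mx 0 v : 'rV[R]_n) *m E) 0 y = E u y - E v y.
Proof. by rewrite mulmxBl -!rowE !mxE. Qed.

(** Outside [{u, v}] the rows of [u] and [v] agree, and on [{u, v}] they are
    [(M u u, M u v)] and [(M u v, M u u)]: their difference is a multiple of
    [e_u - e_v]. *)
Lemma swap_eigenvector M u v :
    (forall x y, M (tperm u v x) (tperm u v y) = M x y) ->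
  (delta_mx 0 u - delta_mx 0 v : 'rV[R]_n) *m M =
    (M u u - M u v) *: (delta_mx 0 u - delta_mx 0 v).
Proof.
move=> swapM; apply/rowP => y; rewrite mul_delta_diff !mxE /=.
rewrite -(swapM v y) tpermR; case: tpermP => [->|->|/eqP/negPf-> /eqP/negPf->].
- have [->|_] := eqVneq u v; first by rewrite !subrr mul0r.
  by rewrite eqxx subr0 mulr1.
- by have [->|_] := eqVneq v u; rewrite ?eqxx ?subrr ?mul0r // sub0r mulrN1 opprB.
- by rewrite !subrr mulr0.
Qed.

(** Since [(e_u - e_v) E = k (e_u - e_v)], both [E u u - E v u] and
    [E v v - E u v] equal [k], and [E] is symmetric. *)
Lemma swap_eigproj_diag M (lambda : R) u v :
    M^T = M -> (forall x y, M (tperm u v x) (tperm u v y) = M x y) ->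
  eigproj M lambda u u = eigproj M lambda v v.
Proof.
move=> symM swapM; have [->//|ne] := eqVneq u v.
have [k] := eigproj_eigenvector lambda symM (swap_eigenvector swapM).
have /matrixP/(_ u v) := eigproj_sym M lambda.
(* generalized so that [mxE] does not unfold the projection *)
move: (eigproj M lambda) => E; rewrite mxE => Evu hE.
have := congr1 (fun w : 'rV_n => w 0 u) hE.
have := congr1 (fun w : 'rV_n => w 0 v) hE.
rewrite !mul_delta_diff !mxE /= !eqxx eq_sym (negPf ne) Evu.
rewrite sub0r subr0 mulrN1 mulr1 => hv hu.
have {hv} : E v v - E u v = k by rewrite -[k]opprK -hv opprB.
by rewrite -hu => /addIr.
Qed.

Lemma strongly_cospectral_parallel M u v :
  strongly_cospectral M u v -> parallel M u v.
Proof.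
move=> sc lambda /sc[->|->]; first by exists 1; rewrite scale1r.
by exists (-1); rewrite scaleN1r.
Qed.

(** Collinear vectors of equal length are equal or opposite.  When
    [E e_v = 0] the scalar [c] is arbitrary, but then [E e_u = c 0 = 0]. *)
Lemma parallel_strongly_cospectral M u v :
    (forall lambda, eigproj M lambda u u = eigproj M lambda v v) ->
  parallel M u v -> strongly_cospectral M u v.
Proof.
move=> diagE par lambda /par[c Eu].
have := eigproj_col_norm M lambda u; have := eigproj_col_norm M lambda v.
rewrite diagE Eu; set b := _ *m char_vec R v => normb.
rewrite -scalemxAr linearZ -scalemxAl normb scalerA -expr2 => /eqP.
rewrite -subr_eq0 -[X in _ - X]scale1r -scalerBl scaler_eq0 subr_eq0 sqrf_eq1.
case/orP=> [/orP[]/eqP->|/eqP b0]; first by left; rewrite scale1r.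
  by right; rewrite scaleN1r.
suff -> : b = 0 by left; rewrite scaler0.
by apply: trmx_inj; rewrite trmx0; apply: row_norm_eq0; rewrite trmxK normb.
Qed.

End SpectralProjections.

Section TwinSwap.
Variables (R : realType) (n : nat) (X : wgraph R n).

Lemma adj_mx_sym : (adj_mx X)^T = adj_mx X.
Proof.
apply/matrixP => x y; rewrite !mxE edge_sym.
by case: ifP => // xy; rewrite weight_sym // edge_sym.
Qed.

Lemma gen_adj_sym (alpha beta gamma : R) :
  (gen_adj X alpha beta gamma)^T = gen_adj X alpha beta gamma.
Proof.
by rewrite /gen_adj !linearD !linearZ /= tr_scalar_mx tr_diag_mx adj_mx_sym.
Qed.

Lemma norm_adj_sym (alpha gamma : R) :
  (norm_adj X alpha gamma)^T = norm_adj X alpha gamma.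
Proof.
rewrite map_trmx; congr map_mx; rewrite /norm_adj_C linearD linearZ /=.
rewrite tr_scalar_mx !trmx_mul !tr_diag_mx mulmxA.
by rewrite map_trmx adj_mx_sym.
Qed.

Variables (u v : 'I_n).
Hypothesis huv : twins X u v.
Let s := tperm u v.

Lemma twins_adj_mx_swap x y : adj_mx X (s x) (s y) = adj_mx X x y.
Proof.
have symA a b : adj_mx X a b = adj_mx X b a.
  by have /matrixP/(_ b a) := adj_mx_sym; rewrite mxE.
have [_ _ A_uv A_uu] := huv; rewrite /s.
case: (tpermP u v x) => [->|->|/eqP xu /eqP xv];
  case: (tpermP u v y) => [->|->|/eqP yu /eqP yv] //.
- by rewrite A_uv.
- by rewrite A_uv.
- by rewrite symA -A_uv // symA.
- by rewrite symA A_uv // symA.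
Qed.

Lemma twins_deg_swap x : deg X (s x) = deg X x.
Proof.
rewrite /deg twins_adj_mx_swap; congr (_ + _).
rewrite (reindex_inj (@perm_inj _ s)); apply: eq_big => y /=.
  by rewrite (inj_eq perm_inj).
by rewrite twins_adj_mx_swap.
Qed.

Lemma twins_gen_adj_swap (alpha beta gamma : R) x y :
  gen_adj X alpha beta gamma (s x) (s y) = gen_adj X alpha beta gamma x y.
Proof.
have:= twins_adj_mx_swap x y; rewrite /gen_adj /deg_mx.
move: (adj_mx X) => A; rewrite !mxE => ->.
by rewrite twins_deg_swap !(inj_eq perm_inj).
Qed.

Lemma twins_norm_adj_swap (alpha gamma : R) x y :
  norm_adj X alpha gamma (s x) (s y) = norm_adj X alpha gamma x y.
Proof.
have:= twins_adj_mx_swap x y; rewrite /norm_adj /norm_adj_C /inv_sqrt_deg_mx.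
rewrite !mul_mx_diag !mul_diag_mx /inv_sqrt_deg.
move: (adj_mx X) => A; rewrite !mxE => ->.
by rewrite !twins_deg_swap !(inj_eq perm_inj).
Qed.

End TwinSwap.

Theorem corollary3p8 (R : realType) (n : nat) (X : wgraph R n)
  (hX : connected_graph X)
  (alpha beta gamma : R) (hgamma : gamma <> 0%R)
  (M : 'M[R]_n)
  (hM : M = gen_adj X alpha beta gamma \/
        (degs_same_sign X /\ M = norm_adj X alpha gamma))
  (u v : 'I_n) (huv : twins X u v) :
  strongly_cospectral M u v <-> parallel M u v.
Proof.
split; first exact: strongly_cospectral_parallel.
apply: parallel_strongly_cospectral => lambda.
case: hM => [->|[_ ->]]; apply: swap_eigproj_diag.
- exact: gen_adj_sym.
- exact: twins_gen_adj_swap.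
- exact: norm_adj_sym.
- exact: twins_norm_adj_swap.
Qed.
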